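(* Let $a\in\mathbb{R}$ with $|a|>1$ and let $$f_n(x)=\sum_{j=0}^n Z_j(n,a)e^{ih_j(n)x},\qquad n\in\mathbb{N},\ x\in\mathbb{R},$$ be a superoscillating sequence, and assume that the entire extensions $f_n(z)$, $z\in\mathbb{C}$, converge to $e^{iaz}$ in the space $A_{1,B}$ for some positive real value $B$. Let $d$ be a positive integer and let $R_\ell\in\mathbb{R}_{+}\cup\{\infty\}$ for $\ell=1,\dots,d$. Let $G_1,\dots,G_d$ be holomorphic functions whose series expansions at zero are given by $$G_\ell(\lambda)=\sum_{m=0}^\infty g_{\ell,m}\lambda^{m},\qquad \ell=1,\dots,d,$$ where the sequences of complex numbers $(g_{\ell,m})_{m\ge0}$ satisfy $$\limsup_{m\to\infty}|g_{\ell,m}|^{1/m}=\frac{1}{R_\ell},\qquad \ell=1,\dots,d.$$ Define $$F_n(x_1,\dots,x_d)=\sum_{j=0}^n Z_j(n,a)\,G_1(x_1h_j(n))\cdots G_d(x_dh_j(n)).$$ Then $F_n(x_1,\dots,x_d)$ admits the supershift property, that is, $$\lim_{n\to\infty}F_n(x_1,\dots,x_d)=G_1(x_1a)\cdots G_d(x_da)$$ uniformly on compact subsets of $\{(x_1,\dots,x_d)\in\mathbb{R}^d:\ |x_\ell|<R'\ \text{for every }\ell=1,\dots,d\}$, where $$R':=\min\left(\frac{R}{|a|},\ \frac{R}{4eB},\ R\right),\qquad R:=\min_{\ell=1,\dots,d}R_\ell.$$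
   Context: Conventions: $\mathbb{R}_+$ is the set of positive reals, $1/\infty=0$, and if $R=\infty$ then $R'=\infty$. Each $G_\ell$ is given by its power series in the disc $|\lambda|<R_\ell$. Function spaces: for $B>0$, $A_{1,B}$ is the Banach space of entire functions $f:\mathbb{C}\to\mathbb{C}$ with $\|f\|_B:=\sup_{\xi\in\mathbb{C}}|f(\xi)|e^{-B|\xi|}<+\infty$, with norm $\|\cdot\|_B$. ''$f_n$ converges to $f$ in $A_{1,B}$'' means that $f_n,f\in A_{1,B}$ and $\|f_n-f\|_B\to 0$. Superoscillating sequence (in one variable): a generalized Fourier sequence is a sequence $f_n(x)=\sum_{j=0}^n Z_j(n,a)e^{ih_j(n)x}$, $n\in\mathbb{N}$, $x\in\mathbb{R}$, where $a\in\mathbb{R}$, the $Z_j(n,a)$ are complex valued and the $h_j(n)$ are real valued. It is superoscillating if $\sup_{j,n}|h_j(n)|\le 1$ and there exists a compact subset of $\mathbb{R}$ (a superoscillation set) on which $f_n(x)$ converges uniformly to $e^{ig(a)x}$, where $g$ is a continuous real valued function such that $|g(a)|>1$. *)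

(* Defs.v *)
From HB Require Import structures.
From mathcomp Require Export all_boot all_order all_algebra.
From mathcomp Require Export all_classical all_reals all_analysis.
From mathcomp Require Export complex.

Set Implicit Arguments.
Unset Strict Implicit.
Unset Printing Implicit Defensive.

Export Order.TTheory GRing.Theory Num.Theory.
Export numFieldNormedType.Exports.

Local Open Scope classical_set_scope.
Local Open Scope ring_scope.

(* The values [R[i]^o] below are complex numbers: only the regular module
   [R[i]^o] carries the canonical topology, uniformity and norm over [R[i]], so
   that [derivable f z 1] is complex differentiability at z. The real-valued
   modulus is [Normc.normc]. *)

Definition cexp (R : realType) (z : R[i]) : R[i]^o :=
  (expR (complex.Re z))%:C%C
    * ((cos (complex.Im z)) +i* (sin (complex.Im z)))%C.

(* Entire extension of x |-> \sum_(0 <= j <= n) Z_j(n,a) e^{i h_j(n) x}; the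
   generalized Fourier sequence itself is its restriction to real z. *)
Definition fourier (R : realType) (Z : forall n, 'I_n.+1 -> R -> R[i])
    (h : forall n, 'I_n.+1 -> R) (a : R) (n : nat) (z : R[i]) : R[i]^o :=
  \sum_(j < n.+1) Z n j a * cexp ('i%C * (h n j)%:C%C * z).

Definition superoscillating (R : realType)
    (Z : forall n, 'I_n.+1 -> R -> R[i])
    (h : forall n, 'I_n.+1 -> R) (a : R) : Prop :=
  (forall n (j : 'I_n.+1), `|h n j| <= 1) /\
  exists g : R -> R, [/\ continuous g, 1 < `|g a| &
    exists K : set R, [/\ compact K, K !=set0 &
      {uniform K, (fun n (x : R) => fourier Z h a n x%:C%C) @ \oo -->
                  (fun x : R => cexp ('i%C * (g a * x)%:C%C))}]].

Section A1B.
Variables (R : realType) (B : R).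
Implicit Type f : R[i]^o -> R[i]^o.

Definition A1_norm f : \bar R :=
  ereal_sup [set (Normc.normc (f z) * expR (- (B * Normc.normc z)))%:E
            | z in [set: R[i]^o]].

Definition entire f : Prop := forall z, derivable f z 1.

Definition in_A1 f : Prop := entire f /\ (A1_norm f < +oo)%E.

Definition cvg_A1 (f_ : nat -> R[i]^o -> R[i]^o) f : Prop :=
  [/\ forall n, in_A1 (f_ n), in_A1 f &
      A1_norm (fun z => f_ n z - f z) @[n --> \oo] --> (0 : \bar R)].

End A1B.

(* G is holomorphic on the disc of radius r, where it is the sum of the power
   series with coefficients g. Nothing is required of G outside the disc. *)
Definition holomorphic_series (R : realType) (r : \bar R)
    (g : nat -> R[i]) (G : R[i]^o -> R[i]^o) : Prop :=
  forall z : R[i]^o, ((Normc.normc z)%:E < r)%E ->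
    derivable G z 1 /\
    (series (fun m => g m * z ^+ m : R[i]^o) : nat -> R[i]^o) @ \oo --> G z.

(* At m = 0 the exponent is 0^-1 = 0, which does not affect the limsup. *)
Definition root_limsup (R : realType) (g : nat -> R[i]) : \bar R :=
  limn_esup (fun m => (Normc.normc (g m) `^ (m%:R^-1))%:E).

Definition radius (R : realType) (d : nat) (r : 'I_d -> \bar R) : \bar R :=
  \big[mine/+oo%E]_(l < d) r l.

(* The division is that of [\bar R]: if r = +oo, the value is +oo for a <> 0
   and B > 0. *)
Definition radius' (R : realType) (a B : R) (r : \bar R) : \bar R :=
  mine (mine (r / `|a|%:E)%E (r / (4 * expR 1 * B)%:E)%E) r.

(* Main.v *)
Require Import Defs.
From mathcomp Require Import cyclic separable cyclotomic.
From mathcomp Require Import ring lra.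
Import Normc.

Set Implicit Arguments.
Unset Strict Implicit.
Unset Printing Implicit Defensive.

Local Open Scope classical_set_scope.
Local Open Scope ring_scope.

(* Put [L_n phi = \sum_j Z_j phi (h_j) - phi a]. Then [L_n] of
   [t |-> e^{i t z}] is [D_n z = f_n z - e^{iaz}], with [|D_n z| <= eps_n e^{B|z|}]
   and [eps_n --> 0]. A Cauchy estimate for [D_n] on the circle of radius [k/B] bounds
   the moments: [|L_n (t^k)| <= eps_n (e B)^k]. Expanding [\prod_l G_l (x_l t)] in
   powers of [t] gives [|F_n - F| <= eps_n \prod_l \sum_m |g_{l,m}| (|x_l| e B)^m],
   and the product is bounded on the compact set because [|x_l| < R / (4 e B)].
   The Cauchy estimate is obtained without contour integrals: the circle is replaced
   by the [N]-th roots of unity, [N --> oo], and [cexp] by its Taylor polynomials. *)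

(** * The real-valued modulus on [R[i]] *)

Section ComplexModulus.
Variable R : realType.
Implicit Types (z w : R[i]) (k x y : R).

Lemma real_complexB x y : (x - y)%:C%C = x%:C%C - y%:C%C.
Proof. exact: rmorphB. Qed.

Lemma normc_norm z : `|z| = (normc z)%:C%C.
Proof. by []. Qed.

Lemma normc_ge0 z : 0 <= normc z.
Proof. by rewrite -lecR -normc_norm normr_ge0. Qed.

Lemma normcR k : normc k%:C%C = `|k|.
Proof. by rewrite /normc /= expr0n /= addr0 sqrtr_sqr. Qed.

Lemma normc_i : normc 'i%C = 1 :> R.
Proof. by rewrite /normc /= expr0n /= add0r expr1n sqrtr1. Qed.

Lemma normcX z n : normc (z ^+ n) = normc z ^+ n.
Proof.
elim: n => [|n IHn]; first by rewrite !expr0 normc1.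
by rewrite !exprS normcM IHn.
Qed.

Lemma normc_sum (I : Type) (s : seq I) (P : pred I) (F : I -> R[i]) :
  normc (\sum_(i <- s | P i) F i) <= \sum_(i <- s | P i) normc (F i).
Proof.
elim/big_ind2: _ => [|x1 x2 y1 y2 le1 le2|//]; first by rewrite normc0.
by rewrite (le_trans (le_normcD _ _)) ?lerD.
Qed.

Lemma normc_prod (I : Type) (s : seq I) (P : pred I) (F : I -> R[i]) :
  normc (\prod_(i <- s | P i) F i) = \prod_(i <- s | P i) normc (F i).
Proof. exact: (big_morph _ (@normcM R) (normc1 R)). Qed.

Lemma normr_Re_le z : `|complex.Re z| <= normc z.
Proof.
by case: z => x y /=; rewrite -sqrtr_sqr ler_sqrt ?addr_ge0 ?sqr_ge0 // lerDl sqr_ge0.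
Qed.

Lemma normr_Im_le z : `|complex.Im z| <= normc z.
Proof.
by case: z => x y /=; rewrite -sqrtr_sqr ler_sqrt ?addr_ge0 ?sqr_ge0 // lerDr sqr_ge0.
Qed.

Lemma normc_le_ReIm z : normc z <= `|complex.Re z| + `|complex.Im z|.
Proof.
case: z => x y /=; rewrite -(ger0_norm (addr_ge0 (normr_ge0 x) (normr_ge0 y))).
rewrite -sqrtr_sqr ler_sqrt ?sqr_ge0 // sqrrD !real_normK ?num_real //.
by rewrite lerD2r lerDl mulrn_wge0 ?mulr_ge0.
Qed.

End ComplexModulus.

(** * Taylor polynomials of the exponential and their distance to [cexp] *)

Section ExpPoly.

Definition exp_poly (F : numFieldType) (N : nat) (x : F) : F :=
  \sum_(m < N) x ^+ m / m`!%:R.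

(** The double sum runs over the triangle p + q < N. Passing from N to N + 1 adds the diagonal p + q
    = N, which is the binomial expansion of (x + y)^N / N!. *)
Lemma exp_polyD (F : numFieldType) N (x y : F) :
  exp_poly N (x + y) =
  \sum_(p < N) \sum_(q < N - p) x ^+ p / p`!%:R * (y ^+ q / q`!%:R).
Proof.
elim: N => [|N IHN]; first by rewrite /exp_poly !big_ord0.
rewrite /exp_poly big_ord_recr /= -/(exp_poly N (x + y)) IHN.
rewrite (eq_bigr (fun p : 'I_N.+1 =>
  \sum_(q < N - p) x ^+ p / p`!%:R * (y ^+ q / q`!%:R)
  + x ^+ p / p`!%:R * (y ^+ (N - p) / (N - p)`!%:R))); last first.
  by move=> p _; rewrite subSn -1?ltnS // big_ord_recr.
rewrite big_split /= big_ord_recr /= subnn big_ord0 addr0; congr (_ + _).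
rewrite addrC exprDn mulr_suml; apply: eq_bigr => p _.
have pN : (p <= N)%N by rewrite -ltnS.
rewrite -(bin_fact pN) !natrM -mulr_natl.
have bn0 : 'C(N, p)%:R != 0 :> F by rewrite pnatr_eq0 -lt0n bin_gt0.
have pn0 : p`!%:R != 0 :> F by rewrite pnatr_eq0 -lt0n fact_gt0.
have qn0 : (N - p)`!%:R != 0 :> F by rewrite pnatr_eq0 -lt0n fact_gt0.
by field; rewrite bn0 pn0 qn0.
Qed.

(* All coefficients are nonnegative, so the modulus of the defect is at most its
   value at real upper bounds of [|x|] and [|y|]. *)
Lemma exp_poly_defect (F : numFieldType) N (x y : F) :
  exp_poly N x * exp_poly N y - exp_poly N (x + y) =
  \sum_(p < N) \sum_(N - p <= q < N) x ^+ p / p`!%:R * (y ^+ q / q`!%:R).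
Proof.
rewrite exp_polyD /exp_poly mulr_suml -sumrB; apply: eq_bigr => p _.
rewrite mulr_sumr -(big_mkord xpredT (fun q => x ^+ p / p`!%:R * (y ^+ q / q`!%:R))).
rewrite -(big_mkord xpredT (fun q => x ^+ p / p`!%:R * (y ^+ q / q`!%:R))).
by rewrite (@big_cat_nat _ _ _ (N - p) 0 N) ?leq_subr //= addrAC subrr add0r.
Qed.

Variable R : realType.
Implicit Types (z w : R[i]) (x y rho : R).

Lemma exp_poly_real N x : exp_poly N (x%:C%C) = (exp_poly N x)%:C%C.
Proof.
rewrite /exp_poly rmorph_sum; apply: eq_bigr => m _.
by rewrite rmorphM rmorphXn fmorphV rmorph_nat.
Qed.

Lemma exp_poly_series x : (fun N => exp_poly N x) = series (exp_coeff x).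
Proof. by apply/funext => N; rewrite /series /= big_mkord. Qed.

Lemma cvg_exp_poly x : exp_poly N x @[N --> \oo] --> expR x.
Proof. by rewrite exp_poly_series; exact: is_cvg_series_exp_coeff. Qed.

Definition exp_tail N rho := expR rho - exp_poly N rho.

Lemma cvg_exp_tail rho : exp_tail N rho @[N --> \oo] --> 0.
Proof.
rewrite -[X in _ --> X](subrr (expR rho)).
by apply: cvgB; [exact: cvg_cst|exact: cvg_exp_poly].
Qed.

Lemma exp_poly_sub N M (F : numFieldType) (x : F) : (N <= M)%N ->
  exp_poly M x - exp_poly N x = \sum_(N <= m < M) x ^+ m / m`!%:R.
Proof.
move=> NM; rewrite /exp_poly -2!(big_mkord xpredT (fun m => x ^+ m / m`!%:R)).
by rewrite (@big_cat_nat _ _ _ N 0 M) //= addrAC subrr add0r.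
Qed.

Lemma normc_fact m : normc (m`!%:R : R[i]) = m`!%:R.
Proof. by rewrite -(rmorph_nat (real_complex R)) normcR ger0_norm. Qed.

Lemma normc_exp_term_le z rho m : normc z <= rho ->
  normc (z ^+ m / m`!%:R) <= rho ^+ m / m`!%:R.
Proof.
move=> zr; rewrite normcM normcX normcV normc_fact ler_pM2r ?invr_gt0 ?ltr0n ?fact_gt0 //.
by rewrite lerXn2r ?nnegrE ?normc_ge0 // (le_trans (normc_ge0 z)).
Qed.

Lemma exp_poly_leR N rho : 0 <= rho -> exp_poly N rho <= expR rho.
Proof.
move=> r0; apply: (cvgr_to_ge (@cvg_exp_poly rho)).
exists N => // M /= NM; rewrite -subr_ge0 exp_poly_sub //.
by apply: sumr_ge0 => m _; rewrite divr_ge0 ?exprn_ge0.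
Qed.

Lemma normc_exp_poly_le N z rho : normc z <= rho -> normc (exp_poly N z) <= expR rho.
Proof.
move=> zr; have r0 : 0 <= rho by rewrite (le_trans (normc_ge0 z)).
apply: le_trans (exp_poly_leR N r0); rewrite (le_trans (normc_sum _ _ _)) //.
by apply: ler_sum => m _; apply: normc_exp_term_le.
Qed.

(** Termwise comparison with the real series at [rho]. The bound does not depend on [M], so it
    survives the limit in [M], and it is uniform over the disc of radius [rho]. *)
Lemma normc_exp_poly_sub_le z rho N M : (N <= M)%N -> normc z <= rho ->
  normc (exp_poly M z - exp_poly N z) <= exp_tail N rho.
Proof.
move=> NM zr; have r0 : 0 <= rho by rewrite (le_trans (normc_ge0 z)).
rewrite exp_poly_sub // (le_trans (normc_sum _ _ _)) //.
apply: (@le_trans _ _ (exp_poly M rho - exp_poly N rho)).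
  by rewrite exp_poly_sub //; apply: ler_sum => m _; apply: normc_exp_term_le.
by rewrite lerD2r exp_poly_leR.
Qed.

Lemma limit_distance_le (u : nat -> R) (l t : R) N :
  u M @[M --> \oo] --> l -> (forall M, (N <= M)%N -> `|u M - u N| <= t) ->
  `|l - u N| <= t.
Proof.
move=> ul ut; have ud : `|u M - u N| @[M --> \oo] --> `|l - u N|.
  by apply: cvg_norm; apply: cvgB => //; exact: cvg_cst.
by apply: (cvgr_to_le ud); exists N => // M /= /ut.
Qed.

Lemma Re_sum (I : Type) (s : seq I) (P : pred I) (F : I -> R[i]) :
  complex.Re (\sum_(i <- s | P i) F i) = \sum_(i <- s | P i) complex.Re (F i).
Proof. exact: raddf_sum. Qed.

Lemma Im_sum (I : Type) (s : seq I) (P : pred I) (F : I -> R[i]) :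
  complex.Im (\sum_(i <- s | P i) F i) = \sum_(i <- s | P i) complex.Im (F i).
Proof. exact: raddf_sum. Qed.

(** Euler's formula term by term: splitting m by parity, i^m is a sign, times i when m is odd.
    Summed over m, it identifies the partial sums of [cos] and [sin] as real and imaginary parts. *)
Lemma exp_term_imaginary y m :
  ('i%C * y%:C%C) ^+ m / m`!%:R = (cos_coeff y m +i* sin_coeff y m)%C :> R[i].
Proof.
rewrite exprMn -[m`!%:R](rmorph_nat (real_complex R)) -rmorphXn -mulrA -fmorphV -rmorphM.
rewrite /cos_coeff /sin_coeff -[in 'i%C ^+ m](odd_double_half m) exprD -mul2n exprM.
have -> : 'i%C ^+ 2 = (-1) :> R[i] by exact: sqr_i.
have -> : (-1) ^+ m./2 = ((-1) ^+ m./2)%:C%C :> R[i].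
  by rewrite rmorphXn rmorphN1.
rewrite /= -exprnP.
have [mo|me] := boolP (odd m).
  (* The sign in [sin_coeff] has exponent [m.-1./2], which agrees with [m./2] for odd m. *)
  have -> : m.-1./2 = m./2 by rewrite -[in LHS](odd_double_half m) mo /= doubleK.
  rewrite -[_ ^+ true]/('i%C).
  by apply/eqP; rewrite eq_complex /=; apply/andP; split; apply/eqP; ring.
rewrite -[_ ^+ false]/(1 : R[i]).
by apply/eqP; rewrite eq_complex /=; apply/andP; split; apply/eqP; ring.
Qed.

Lemma Re_exp_poly_i N y :
  complex.Re (exp_poly N ('i%C * y%:C%C)) = series (cos_coeff y) N.
Proof.
by rewrite Re_sum /series /= big_mkord; apply: eq_bigr => m _; rewrite exp_term_imaginary.
Qed.

Lemma Im_exp_poly_i N y :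
  complex.Im (exp_poly N ('i%C * y%:C%C)) = series (sin_coeff y) N.
Proof.
by rewrite Im_sum /series /= big_mkord; apply: eq_bigr => m _; rewrite exp_term_imaginary.
Qed.

Lemma exp_poly_expR_dist N x rho : `|x| <= rho ->
  normc ((expR x)%:C%C - exp_poly N x%:C%C) <= exp_tail N rho.
Proof.
move=> xr; rewrite exp_poly_real -rmorphB normcR.
apply: (limit_distance_le (@cvg_exp_poly x)) => M NM.
by rewrite -normcR real_complexB -!exp_poly_real normc_exp_poly_sub_le ?normcR.
Qed.

Lemma exp_poly_cis_dist N y rho : `|y| <= rho ->
  normc ((cos y +i* sin y)%C - exp_poly N ('i%C * y%:C%C)) <= exp_tail N rho *+ 2.
Proof.
move=> yr; rewrite (le_trans (normc_le_ReIm _)) // !raddfB /= mulr2n.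
have iy : normc ('i%C * y%:C%C) <= rho by rewrite normcM normc_i mul1r normcR.
have H M : (N <= M)%N -> normc (exp_poly M ('i%C * y%:C%C) - exp_poly N ('i%C * y%:C%C))
    <= exp_tail N rho by move=> NM; apply: normc_exp_poly_sub_le.
apply: lerD.
- rewrite Re_exp_poly_i; apply: limit_distance_le.
    by rewrite cos.unlock; exact: is_cvg_series_cos_coeff.
  move=> M NM; rewrite -!Re_exp_poly_i -raddfB.
  by rewrite (le_trans (normr_Re_le _)) ?H.
- rewrite Im_exp_poly_i; apply: limit_distance_le.
    by rewrite sin.unlock; exact: is_cvg_series_sin_coeff.
  move=> M NM; rewrite -!Im_exp_poly_i -raddfB.
  by rewrite (le_trans (normr_Im_le _)) ?H.
Qed.

Lemma exp_poly_defect_le N z w rho : normc z <= rho -> normc w <= rho ->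
  normc (exp_poly N z * exp_poly N w - exp_poly N (z + w)) <=
  exp_poly N rho * exp_poly N rho - exp_poly N (rho + rho).
Proof.
move=> zr wr; rewrite !exp_poly_defect (le_trans (normc_sum _ _ _)) //.
apply: ler_sum => p _; rewrite (le_trans (normc_sum _ _ _)) //.
by apply: ler_sum => q _; rewrite normcM ler_pM ?normc_ge0 ?normc_exp_term_le.
Qed.

(** One summand for each source of error in e^x (cos y + i sin y): the truncation of e^x, the
    truncation of the trigonometric factor (one tail for each of its two parts), and the failure of
    [exp_poly] to be multiplicative. The last one vanishes in the limit because e^rho e^rho = e^(2
    rho). *)
Definition cexp_error N rho : R :=
  exp_tail N rho + expR rho * exp_tail N rho *+ 2 +
  (exp_poly N rho * exp_poly N rho - exp_poly N (rho + rho)).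

Lemma cvg_cexp_error rho : cexp_error N rho @[N --> \oo] --> 0.
Proof.
have -> : 0 = 0 + expR rho * 0 *+ 2 + (expR rho * expR rho - expR (rho + rho)) :> R.
  by rewrite expRD; ring.
apply: cvgD; first apply: cvgD.
- exact: cvg_exp_tail.
- by under eq_fun do rewrite -mulr_natl; rewrite -mulr_natl;
    apply: cvgMr; apply: cvgMr; exact: cvg_exp_tail.
- by apply: cvgB; [apply: cvgM|]; exact: cvg_exp_poly.
Qed.

Lemma normc_cis y : normc (cos y +i* sin y)%C = 1.
Proof. by rewrite /normc cos2Dsin2 sqrtr1. Qed.

Lemma cexp_exp_poly_dist N w rho : normc w <= rho ->
  normc (cexp w - exp_poly N w) <= cexp_error N rho.
Proof.
move=> wr; pose x := complex.Re w; pose y := complex.Im w.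
have xr : `|x| <= rho := le_trans (normr_Re_le w) wr.
have yr : `|y| <= rho := le_trans (normr_Im_le w) wr.
have iy : normc ('i%C * y%:C%C) <= rho by rewrite normcM normc_i mul1r normcR.
have wE : w = x%:C%C + 'i%C * y%:C%C by rewrite /x /y; case: (w) => u v; simpc.
have r0 : 0 <= rho := le_trans (normc_ge0 w) wr.
(* Telescoping: one factor is replaced at a time, and then the product of polynomials by the
   polynomial of the sum. *)
have -> : cexp w - exp_poly N w =
  ((expR x)%:C%C - exp_poly N x%:C%C) * (cos y +i* sin y)%C +
  exp_poly N x%:C%C * ((cos y +i* sin y)%C - exp_poly N ('i%C * y%:C%C)) +
  (exp_poly N x%:C%C * exp_poly N ('i%C * y%:C%C) - exp_poly N (x%:C%C + 'i%C * y%:C%C)).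
  by rewrite -wE /cexp -/x -/y; ring.
rewrite (le_trans (le_normcD _ _)) // lerD ?exp_poly_defect_le ?normcR //.
rewrite (le_trans (le_normcD _ _)) // lerD //.
  by rewrite normcM normc_cis mulr1 exp_poly_expR_dist.
rewrite normcM -mulrnAr ler_pM ?normc_ge0 ?exp_poly_cis_dist //.
by rewrite normc_exp_poly_le ?normcR.
Qed.

End ExpPoly.

(** * Roots of unity and the Cauchy estimate for exponential sums *)

Section Moments.

(** X^n - 1 splits and is separable in characteristic 0, so it has n distinct roots, and n distinct
    n-th roots of unity include a primitive one. *)
Lemma prim_root_exists (F : numClosedFieldType) n :
  (0 < n)%N -> exists w : F, n.-primitive_root w.
Proof.
pose p : {poly F} := 'X^n - 1; have [s Dp] := closed_field_poly_normal p.
move=> n_gt0; rewrite (monicP _) ?monicXnsubC // scale1r in Dp.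
have sn1 : all n.-unity_root s by apply/allP=> z; rewrite -root_prod_XsubC -Dp.
have sz_s : (n < (size s).+1)%N by rewrite -(size_prod_XsubC s id) -Dp size_XnsubC.
have [|z] := hasP (has_prim_root n_gt0 sn1 _ sz_s); last by exists z.
by rewrite -separable_prod_XsubC -Dp separable_Xn_sub_1 // pnatr_eq0 -lt0n.
Qed.

Lemma prim_root_orthogonal (F : fieldType) n (w : F) (m k : 'I_n) :
  n.-primitive_root w ->
  \sum_(s < n) (w ^+ s) ^+ m / (w ^+ s) ^+ k = (m == k)%:R * n%:R.
Proof.
move=> pw; have w0 : w != 0 by rewrite (prim_root_eq0 pw) -lt0n (leq_ltn_trans _ (ltn_ord m)).
under eq_bigr do rewrite -!exprM ![(_ * m)%N]mulnC ![(_ * k)%N]mulnC !exprM -exprVn -exprMn.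
have [->|mk] := eqVneq m k.
  rewrite divff ?expf_neq0 // mul1r.
  by under eq_bigr do rewrite expr1n; rewrite sumr_const card_ord.
have q1 : w ^+ m / w ^+ k - 1 != 0.
  rewrite subr_eq0; apply: contra mk => /eqP q1.
  have /eqP : w ^+ m = w ^+ k by rewrite -[LHS](divfK (expf_neq0 k w0)) q1 mul1r.
  by rewrite (eq_prim_root_expr pw) !modn_small.
(* Geometric sum of ratio q = w^m / w^k, distinct from 1: (q - 1) times the sum is q^n - 1 = 0. *)
apply: (mulfI q1); rewrite -subrX1 mul0r mulr0 exprMn exprVn -!exprM.
by rewrite ![(_ * n)%N]mulnC !exprM (prim_expr_order pw) !expr1n divr1 subrr.
Qed.

(** Discrete Cauchy formula. It is exact because every exponent in [exp_poly n] is below n, so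
    distinct exponents stay orthogonal on the n-th roots of unity. *)
Lemma exp_poly_prim_root_sum (F : numFieldType) n (w z : F) (k : 'I_n) :
  n.-primitive_root w ->
  \sum_(s < n) exp_poly n (z * w ^+ s) / (w ^+ s) ^+ k = n%:R * (z ^+ k / k`!%:R).
Proof.
move=> pw; rewrite /exp_poly.
under eq_bigr do rewrite mulr_suml.
rewrite exchange_big (bigD1 k) //= [X in _ + X]big1 => [|m mk].
  rewrite addr0 (eq_bigr (fun s : 'I_n => (z ^+ k / k`!%:R) * ((w ^+ s) ^+ k / (w ^+ s) ^+ k))).
    by rewrite -mulr_sumr prim_root_orthogonal // eqxx mul1r mulrC.
  by move=> s _; rewrite exprMn; ring.
rewrite (eq_bigr (fun s : 'I_n => (z ^+ m / m`!%:R) * ((w ^+ s) ^+ m / (w ^+ s) ^+ k))).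
  by rewrite -mulr_sumr prim_root_orthogonal // (negbTE mk) mul0r mulr0.
by move=> s _; rewrite exprMn; ring.
Qed.

Lemma normc_prim_root (R : realType) n (w : R[i]) :
  (0 < n)%N -> n.-primitive_root w -> normc w = 1.
Proof.
move=> n0 /prim_expr_order wn.
by apply/eqP; rewrite -(@pexpr_eq1 _ _ n) ?normc_ge0 // -normcX wn normc1.
Qed.

Lemma fact_leq_exp k : (k`! <= k ^ k)%N.
Proof.
rewrite fact_prod -[X in (_ <= _ ^ X)%N](subn1 k.+1) subSS subn0.
rewrite -[X in (_ <= _ ^ X)%N]subn0 -(subSS 0 k) -prod_nat_const_nat.
by rewrite !big_nat; apply: leq_prod => i /andP[_].
Qed.

Variables (R : realType) (I : finType) (c l : I -> R[i]) (eps B : R).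
Hypothesis exp_type : forall z : R[i],
  normc (\sum_j c j * cexp (l j * z)) <= eps * expR (B * normc z).

(** Cauchy's inequality on the circle of radius r: the moment divided by k! is the k-th Taylor
    coefficient of the exponential sum. For each N > k, sampling at the N-th roots of unity gives
    the inequality up to an error that tends to 0 with N. *)
Lemma cauchy_moment_le k r : 0 <= r ->
  normc (\sum_j c j * l j ^+ k) * (r ^+ k / k`!%:R) <= eps * expR (B * r).
Proof.
(* [rho] dominates |l_j z| for all j at once when |z| = r, so one [cexp_error N rho] serves every
   term, with total weight [C]. *)
move=> r0; pose rho := \sum_j normc (l j) * r; pose C := \sum_j normc (c j).
have lim : eps * expR (B * r) + C * cexp_error N rho @[N --> \oo] -->
    eps * expR (B * r) + C * 0.
  by apply: cvgD; [exact: cvg_cst|apply: cvgMr; exact: cvg_cexp_error].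
rewrite mulr0 addr0 in lim; apply: (cvgr_to_ge lim).
exists k.+1 => // N /= kN; pose k' := Ordinal kN.
have N0 : (0 < N)%N := leq_ltn_trans (leq0n k) kN.
have [w pw] := @prim_root_exists R[i] N N0.
have w1 s : normc (w ^+ s) = 1 by rewrite normcX (normc_prim_root N0 pw) expr1n.
have NR : 0 < N%:R :> R by rewrite ltr0n.
rewrite -(ler_pM2l NR).
have -> : N%:R * (normc (\sum_j c j * l j ^+ k) * (r ^+ k / k`!%:R)) =
    normc (\sum_(s < N) (\sum_j c j * exp_poly N (l j * (r%:C%C * w ^+ s))) / (w ^+ s) ^+ k).
  under [in RHS]eq_bigr do rewrite mulr_suml.
  rewrite exchange_big /=.
  under [in RHS]eq_bigr => j _.
    under eq_bigr do rewrite -mulrA [l j * _]mulrA.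
    rewrite -mulr_sumr.
    rewrite (exp_poly_prim_root_sum (l j * r%:C%C) k' pw) /=.
    rewrite (_ : c j * _ = N%:R * (r%:C%C ^+ k / k`!%:R) * (c j * l j ^+ k)); last first.
      by rewrite exprMn; ring.
    over.
  rewrite -mulr_sumr !normcM normcX normcV normc_fact normcR (ger0_norm r0).
  by rewrite -(rmorph_nat (real_complex R)) normcR (ger0_norm (ltW NR)); ring.
rewrite (le_trans (normc_sum _ _ _)) //.
(* Each of the N sample points obeys the same bound, which absorbs the factor N. *)
rewrite [leRHS](_ : _ = \sum_(s < N) (eps * expR (B * r) + C * cexp_error N rho)); last first.
  by rewrite sumr_const card_ord mulr_natl.
apply: ler_sum => s _; rewrite normcM normcV normcX w1 expr1n invr1 mulr1.
set z := r%:C%C * w ^+ s; have zr : normc z = r by rewrite normcM w1 mulr1 normcR ger0_norm.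
rewrite (_ : \sum_j _ = \sum_j c j * cexp (l j * z)
   - \sum_j c j * (cexp (l j * z) - exp_poly N (l j * z))); last first.
  by rewrite -sumrB; apply: eq_bigr => j _; ring.
rewrite (le_trans (le_normcD _ _)) // normcN lerD //.
  by rewrite -[in leRHS]zr exp_type.
rewrite (le_trans (normc_sum _ _ _)) // mulr_suml; apply: ler_sum => j _.
rewrite normcM ler_wpM2l ?normc_ge0 // cexp_exp_poly_dist // normcM zr.
by rewrite /rho (bigD1 j) //= lerDl sumr_ge0 // => i _; rewrite mulr_ge0 ?normc_ge0.
Qed.

(** The radius r = k / B minimizes e^(B r) / r^k and turns e^(B r) into e^k; then k! <= k^k absorbs
    the factorial. For k = 0 the radius is 0 and 0^0 = 1. *)
Lemma moment_le k : 0 < B -> normc (\sum_j c j * l j ^+ k) <= eps * (expR 1 * B) ^+ k.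
Proof.
move=> B0; have := @cauchy_moment_le k (k%:R / B) (divr_ge0 (ler0n _ _) (ltW B0)).
rewrite [B * _]mulrCA divff ?gt_eqF // mulr1 -[X in expR X]mulr1 expRM_natl.
set m := normc _ => mle.
have Bk : 0 < B ^+ k by rewrite exprn_gt0.
rewrite exprMn mulrA -ler_pdivrMr //; apply: le_trans mle.
rewrite ler_wpM2l ?normc_ge0 // expr_div_n mulrAC -[leLHS]mul1r ler_pM2r ?invr_gt0 //.
by rewrite ler_pdivlMr ?ltr0n ?fact_gt0 // mul1r -natrX ler_nat fact_leq_exp.
Qed.

End Moments.

(** * From moment bounds to products of power series *)

Section ProductFunctional.
Variable R : realType.

Lemma cvg_complex_dist (u : nat -> R[i]^o) (v : R[i]^o) :
  u M @[M --> \oo] --> v ->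
  forall e : R, 0 < e -> \forall M \near \oo, normc (u M - v) < e.
Proof.
move=> uv e e0; have e0' : 0 < (e%:C%C : R[i]) by rewrite ltcR.
have /cvgrPdist_lt /(_ _ e0') := uv.
by apply: filterS => M; rewrite distrC normc_norm ltcR.
Qed.

Lemma normc_lim_le (u : nat -> R[i]^o) (v : R[i]^o) (b : R) :
  u M @[M --> \oo] --> v -> (forall M, normc (u M) <= b) -> normc v <= b.
Proof.
move=> uv ub; apply/ler_addgt0Pr => e e0.
have [M _ /(_ M (leqnn M)) uMv] := cvg_complex_dist uv e0.
rewrite -[v](subrK (u M)) addrC (le_trans (le_normcD _ _)) // lerD //.
by rewrite -normcN opprB ltW.
Qed.

Variables (I : finType) (c t : I -> R[i]) (eps q : R).
Hypothesis moments_le : forall k, normc (\sum_j c j * t j ^+ k) <= eps * q ^+ k.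

Lemma prod_poly_functional_le d M (a : 'I_d -> 'I_M -> R[i]) :
  normc (\sum_j c j * \prod_(l < d) \sum_(m < M) a l m * t j ^+ m) <=
  eps * \prod_(l < d) \sum_(m < M) normc (a l m) * q ^+ m.
Proof.
rewrite (eq_bigr (fun j => \sum_(f : {ffun 'I_d -> 'I_M})
    (\prod_(l < d) a l (f l)) * (c j * t j ^+ \sum_(l < d) f l))); last first.
  move=> j _; rewrite bigA_distr_bigA mulr_sumr; apply: eq_bigr => f _.
  by rewrite big_split /= -expr_sum; ring.
rewrite exchange_big bigA_distr_bigA mulr_sumr.
rewrite (le_trans (normc_sum _ _ _)) //; apply: ler_sum => f _.
rewrite -mulr_sumr normcM normc_prod big_split /= -expr_sum mulrCA.
by rewrite ler_wpM2l // prodr_ge0 // => l _; rewrite normc_ge0.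
Qed.

Lemma prod_series_functional_le d (a : 'I_d -> nat -> R[i])
    (v : 'I_d -> I -> R[i]^o) (b : R) :
  (forall l j, (series (fun m => a l m * t j ^+ m : R[i]^o) : nat -> R[i]^o) @ \oo --> v l j) ->
  0 <= q -> 0 <= eps ->
  (forall l M, \sum_(m < M) normc (a l m) * q ^+ m <= b) ->
  normc (\sum_j c j * \prod_(l < d) v l j) <= eps * b ^+ d.
Proof.
move=> av q0 eps0 ab.
(* All series are truncated at the same M. The sum over j is finite, so pointwise convergence
   suffices, and the polynomial bound is uniform in M. *)
apply: (@normc_lim_le (fun M => \sum_j c j * \prod_(l < d) \sum_(m < M) a l m * t j ^+ m)).
  apply: (@cvg_big _ _ +%R) => [|j _]; first exact: add_continuous.
  apply: (@cvgM R[i]); first exact: cvg_cst.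
  apply: (@cvg_big (R[i]^o) _ (@GRing.mul R[i])) => [|l _]; first exact: (@mul_continuous R[i]).
  have := av l j; rewrite /series /=.
  by under eq_fun do rewrite big_mkord.
move=> M; apply: le_trans (prod_poly_functional_le (fun l (m : 'I_M) => a l m)) _.
rewrite ler_wpM2l // -[X in b ^+ X](card_ord d) -prodr_const.
apply: ler_prod => l _; rewrite ab andbT.
by apply: sumr_ge0 => m _; rewrite mulr_ge0 ?normc_ge0 ?exprn_ge0.
Qed.

(** The terms tend to 0. At a point s > 0 of the disc of convergence this yields the coefficient
    bound |a_m| <= C / s^m. *)
Lemma cvg_series_terms_bounded (a : nat -> R[i]) (s : R) (v : R[i]^o) :
  (series (fun m => a m * s%:C%C ^+ m : R[i]^o) : nat -> R[i]^o) @ \oo --> v ->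
  exists C, forall m, normc (a m) * `|s| ^+ m <= C.
Proof.
move=> /cvgP /cvg_series_cvg_0 /cvg_complex_dist /(_ 1 ltr01) [N _ HN].
exists (1 + \sum_(m < N) normc (a m) * `|s| ^+ m) => m.
have pos k : 0 <= normc (a k) * `|s| ^+ k by rewrite mulr_ge0 ?normc_ge0 ?exprn_ge0.
have [Nm|mN] := leqP N m.
  have := HN m Nm; rewrite subr0 normcM normcX normcR => /ltW mle.
  by rewrite (le_trans mle) // lerDl sumr_ge0.
rewrite (bigD1 (Ordinal mN)) //= addrCA lerDl addr_ge0 // sumr_ge0 //.
Qed.

End ProductFunctional.

(** * Uniform estimates on the compact set and the supershift limit *)

Lemma geometric_half_sum_le (R : realType) (N : nat) : \sum_(m < N) (2^-1 : R) ^+ m <= 2.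
Proof.
suff -> : \sum_(m < N) (2^-1 : R) ^+ m = 2 - 2 * 2^-1 ^+ N.
  by rewrite lerBlDr lerDl mulr_ge0 ?exprn_ge0.
elim: N => [|N IHN]; first by rewrite big_ord0 expr0; ring.
by rewrite big_ord_recr /= IHN exprS; field.
Qed.

Lemma uniform_complex_cvg (R : realType) (T : choiceType) (K : set T)
    (f_ : nat -> T -> R[i]^o) (f : T -> R[i]^o) :
  (forall e : R, 0 < e ->
    \forall n \near \oo, forall x, K x -> normc (f_ n x - f x) < e) ->
  {uniform K, f_ @ \oo --> f}.
Proof.
move=> near_f P /uniform_nbhs[E [entE EP]].
move: entE; rewrite -entourage_from_ballE => -[e /= e0 eE].
(* Radii of balls in [R[i]^o] are elements of [R[i]]; positivity there forces the imaginary part to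
   be 0. *)
have eR : e = (complex.Re e)%:C%C.
  by move: e0; rewrite ltcE /= => /andP[/eqP e0 _]; case: (e) e0 => u v /= ->.
have e0' : 0 < complex.Re e by move: e0; rewrite eR ltcR.
apply: filterS (near_f _ e0') => n fn; apply: EP => x Kx; apply: eE => /=.
by rewrite -ball_normE /= distrC normc_norm eR ltcR fn.
Qed.

Lemma lte_pdiv_fin (R : realType) (x k : R) (y : \bar R) :
  0 < k -> (x%:E < y / k%:E)%E -> ((x * k)%:E < y)%E.
Proof. by move=> k0; rewrite inver gt_eqF // lte_pdivlMr. Qed.

Lemma A1_norm_le (R : realType) (B e : R) (f : R[i]^o -> R[i]^o) :
  (A1_norm B f <= e%:E)%E -> forall z, normc (f z) <= e * expR (B * normc z).
Proof.
move=> fe z; rewrite -ler_pdivrMr ?expR_gt0 // -expRN -lee_fin.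
by apply: le_trans fe; apply: ereal_sup_ubound; exists z.
Qed.

Lemma row_entry_le (R : realType) d (x : 'rV[R]_d) l : `|x ord0 l| <= `|x|.
Proof.
rewrite [`|x|]mx_normrE.
exact: (le_bigmax _ (fun ij : 'I_1 * 'I_d => `|x ij.1 ij.2|) (ord0, l)).
Qed.

(* Uniformly over the compact set, [|x_l| * q] stays below half of a point [s]
   of the open disc of convergence; compactness is needed only for an infinite radius. *)
Lemma compact_polydisc_margin (R : realType) d (K : set 'rV[R]_d) (q : R)
    (r : \bar R) : compact K -> 0 < q -> (0 < r)%E ->
  (forall x l, K x -> (`|x ord0 l|%:E < r / (4 * q)%:E)%E) ->
  exists s : R, [/\ 0 < s, (s%:E < r)%E &
    forall x l, K x -> `|x ord0 l| * q <= s / 2].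
Proof.
move=> cK q0; case: r => [r||//]; rewrite ?lte_fin => r0 Kr.
  (* From |x_l| * 4q < r one gets |x_l| * q < r / 4, which is half of this point. *)
  exists (r / 2); split; [by rewrite divr_gt0|by rewrite lte_fin; lra|].
  by move=> x l /(Kr x l) /lte_pdiv_fin; rewrite lte_fin mulr_gt0 // => /(_ isT); lra.
have [M [_ /(_ (`|M| + 1))]] := compact_bounded cK.
rewrite (le_lt_trans (ler_norm M)) ?ltrDl // => /(_ isT) KM.
(* Infinite radius: [|M| + 1] bounds the norm on [K], and s is chosen so that s / 2 is this bound
   times q. *)
exists (2 * ((`|M| + 1) * q)); split; rewrite ?ltry //.
  by rewrite !mulr_gt0 // ltr_wpDl.
move=> x l Kx; rewrite mulrAC divff // mul1r ler_pM2r //.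
exact: le_trans (row_entry_le x l) (KM x Kx).
Qed.

(** Since |g_m| <= C / s^m and |x| q / s <= 1/2, the m-th term is at most C / 2^m. *)
Lemma geometric_majorant_le (R : realType) (g : nat -> R[i]) (s C x q : R) :
  0 < s -> 0 <= q -> (forall m, normc (g m) * s ^+ m <= C) -> `|x| * q <= s / 2 ->
  forall M, \sum_(m < M) normc (g m * x%:C%C ^+ m) * q ^+ m <= C * 2.
Proof.
move=> s0 q0 gC xq M.
have C0 : 0 <= C by rewrite (le_trans _ (gC 0%N)) ?mulr_ge0 ?normc_ge0 ?expr0.
apply: le_trans (ler_wpM2l C0 (geometric_half_sum_le R M)).
rewrite mulr_sumr; apply: ler_sum => m _.
rewrite normcM normcX normcR -mulrA -exprMn.
apply: (@le_trans _ _ (normc (g m) * (s / 2) ^+ m)).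
  by rewrite ler_wpM2l ?normc_ge0 // lerXn2r ?nnegrE ?mulr_ge0 ?invr_ge0 // ltW.
by rewrite exprMn mulrA ler_wpM2r ?exprn_ge0.
Qed.

Theorem theorem4p7 (R : realType) (a : R) (ha : 1 < `|a|)
    (Z : forall n, 'I_n.+1 -> R -> R[i]) (h : forall n, 'I_n.+1 -> R)
    (hsuper : superoscillating Z h a)
    (B : R) (hB : 0 < B)
    (hcvg : cvg_A1 B (fourier Z h a) (fun z => cexp ('i%C * a%:C%C * z)))
    (d : nat) (hd : (0 < d)%N)
    (r : 'I_d -> \bar R) (hr : forall l, (0 < r l)%E)
    (g : 'I_d -> nat -> R[i]) (G : 'I_d -> R[i]^o -> R[i]^o)
    (hG : forall l, holomorphic_series (r l) (g l) (G l))
    (hg : forall l, root_limsup (g l) = ((r l)^-1)%E)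
    (K : set 'rV[R]_d) (hK : compact K)
    (hKsub : K `<=` [set x : 'rV[R]_d | forall l : 'I_d,
                      (`|x ord0 l|%:E < radius' a B (radius r))%E]) :
  {uniform K,
    (fun n (x : 'rV[R]_d) =>
       (\sum_(j < n.+1) Z n j a * \prod_(l < d) G l (x ord0 l * h n j)%:C%C)
         : R[i]^o) @ \oo -->
    (fun x : 'rV[R]_d => (\prod_(l < d) G l (x ord0 l * a)%:C%C) : R[i]^o)}.
Proof.
pose q := expR 1 * B; have q0 : 0 < q by rewrite mulr_gt0 ?expR_gt0.
have a0 : 0 < `|a| by rewrite (lt_trans ltr01).
have rle l : (radius r <= r l)%E by exact: bigmin_le.
have r0 : (0 < radius r)%E by apply: lt_bigmin => // l _.
have Kr x l : K x -> [/\ (`|x ord0 l|%:E < radius r / `|a|%:E)%E,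
    (`|x ord0 l|%:E < radius r / (4 * q)%:E)%E & (`|x ord0 l|%:E < radius r)%E].
  by move=> /hKsub /(_ l); rewrite /radius' !lt_min /q mulrA => /andP[/andP[]].
have [s [s0 sr Ks]] := compact_polydisc_margin hK q0 r0
  (fun x l Kx => let: And3 _ Kq _ := Kr x l Kx in Kq).
have /choice[C gC] l : exists C, forall m, normc (g l m) * s ^+ m <= C.
  have [] := hG l s%:C%C; first by rewrite normcR gtr0_norm // (lt_le_trans sr).
  by move=> _ /cvg_series_terms_bounded; rewrite gtr0_norm.
(* A single bound for all l; the sum of nonnegative terms stands in for a maximum. *)
pose b := \sum_l `|C l| * 2.
have gb x l M : K x -> \sum_(m < M) normc (g l m * (x ord0 l)%:C%C ^+ m) * q ^+ m <= b.
  move=> Kx; apply: le_trans (geometric_majorant_le s0 (ltW q0) (gC l) (Ks x l Kx) M) _.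
  rewrite (le_trans (ler_wpM2r _ (ler_norm (C l)))) //.
  by rewrite /b (bigD1 l) //= lerDl sumr_ge0 // => i _; rewrite mulr_ge0.
have b0 : 0 <= b by apply: sumr_ge0 => l _; rewrite mulr_ge0.
apply: uniform_complex_cvg => e e0.
(* Adding 1 keeps the denominator positive and makes eps * b^d < e strict. *)
pose eps := e / (b ^+ d + 1); have bd0 : 0 < b ^+ d + 1 by rewrite ltr_wpDl ?exprn_ge0.
have eps0 : 0 < eps by rewrite divr_gt0.
have [_ _ D0] := hcvg.
have near_eps : \forall n \near \oo, (A1_norm B (fun z =>
    (fourier Z h a n z - cexp ('i%C * a%:C%C * z))%R) < eps%:E)%E.
  exact: (D0 _ (@nbhs_open_ereal_lt R 0 (fun=> eps) eps0)).
apply: filterS near_eps => n /ltW /A1_norm_le Dn x Kx.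
(* The extra index carries weight -1 at the node a, so that L_n becomes a single weighted sum over
   the nodes [t]. *)
pose c (j : unit + 'I_n.+1) := if j is inr j' then Z n j' a else -1.
pose t (j : unit + 'I_n.+1) := if j is inr j' then h n j' else a.
have exp_type (z : R[i]) :
    normc (\sum_j c j * cexp ('i%C * (t j)%:C%C * z)) <= eps * expR (B * normc z).
  rewrite big_sumType /= big_const card_unit /= addr0 mulN1r addrC.
  exact: Dn.
have moments k : normc (\sum_j c j * (t j)%:C%C ^+ k) <= eps * q ^+ k.
  apply: le_trans (moment_le exp_type k hB).
  (* The frequencies are i t_j; the common factor i^k has modulus 1. *)
  under [in leRHS]eq_bigr do rewrite exprMn mulrCA.
  by rewrite -mulr_sumr normcM normcX normc_i expr1n mul1r.
(* All evaluation points lie in the disc of G_l: at the node a because |x_l| < R / |a|, at the nodes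
   h_j because |x_l| < R and |h_j| <= 1. *)
have Kt l j : ((`|x ord0 l * t j|)%:E < r l)%E.
  have [xa _ xr] := Kr x l Kx; apply: lt_le_trans (rle l).
  case: j => [_|j] /=; first by rewrite normrM lte_pdiv_fin.
  by apply: le_lt_trans xr; rewrite lee_fin normrM ler_piMr //; case: hsuper.
have G_le := @prod_series_functional_le R _ c (fun j => (t j)%:C%C) eps q moments d
  (fun l m => g l m * (x ord0 l)%:C%C ^+ m) (fun l j => G l (x ord0 l * t j)%:C%C) b.
rewrite (_ : _ - _ = \sum_j c j * \prod_(l < d) G l (x ord0 l * t j)%:C%C); last first.
  by rewrite big_sumType /= big_const card_unit /= addr0 mulN1r addrC.
apply: le_lt_trans (G_le _ (ltW q0) (ltW eps0) _) _.
- move=> l j; have [|_] := hG l (x ord0 l * t j)%:C%C; first by rewrite normcR.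
  by under eq_fun do rewrite rmorphM exprMn mulrA.
- by move=> l M; exact: gb.
- by rewrite /eps mulrAC ltr_pdivrMr // ltr_pM2l // ltrDl.
Qed.
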